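(* Let $d=1$, $c(x,y)=\frac12|x-y|^2$, $\nu=\frac12\delta_0+\frac12\delta_1$, let $p\in[1,\infty)$, and let $\mathcal P_{\mathrm{Lip}}(\mathbb{R})$ denote the set of probability measures on $\mathbb{R}$ with Lipschitz densities. Then there is a constant $c_p>0$ such that for all sufficiently large $n$, $$\inf_{T^{(n)}}\ \sup_{\mu\in\mathcal P_{\mathrm{Lip}}(\mathbb{R})}\ \mathbb{E}_\mu\Big[\big\|T^{(n)}-T_{\mu,\nu}\big\|^p_{L^p(\mu)}\Big]\ \ge\ \frac{c_p}{\sqrt n},$$ where the infimum is over all maps $T^{(n)}$ constructed (measurably) from $n$ i.i.d. samples of $\mu$.
   Context: $T_{\mu,\nu}$ denotes the optimal transport map from $\mu$ to $\nu$ for the quadratic cost (the unique, up to $\mu$-null sets, minimizer of $\int c(x,T(x))d\mu(x)$ among maps pushing $\mu$ to $\nu$). $\mathbb{E}_\mu$ denotes expectation over the $n$ i.i.d. samples drawn from $\mu$. *)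

(* Defs.v *)
From HB Require Import structures.
From Stdlib Require Import ClassicalEpsilon.
From mathcomp Require Import all_boot all_order all_algebra.
From mathcomp Require Import all_classical all_reals all_analysis.

Set Implicit Arguments.
Unset Strict Implicit.
Unset Printing Implicit Defensive.

Import Order.TTheory GRing.Theory Num.Theory.
Import numFieldNormedType.Exports.

Local Open Scope classical_set_scope.
Local Open Scope ring_scope.

Section OTminimax.
Variable R : realType.

Definition qcost (x y : R) : R := 2^-1 * (x - y) ^+ 2.

Definition nu_target (A : set R) : \bar R :=
  ((2^-1)%:E * \d_(0%R : R) A + (2^-1)%:E * \d_(1%R : R) A)%E.

Definition pushes (mu : set R -> \bar R) (T : R -> R)
    (nu : set R -> \bar R) : Prop :=
  forall A : set R, measurable A -> pushforward mu T A = nu A.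

Definition is_ot_map (mu : probability R R) (T : R -> R) : Prop :=
  [/\ measurable_fun [set: R] T, pushes mu T nu_target &
    forall S : R -> R, measurable_fun [set: R] S -> pushes mu S nu_target ->
      (\int[mu]_x (qcost x (T x))%:E <= \int[mu]_x (qcost x (S x))%:E)%E].

Definition ot_well_defined (mu : probability R R) : Prop :=
  (exists T, is_ot_map mu T) /\
  forall T1 T2, is_ot_map mu T1 -> is_ot_map mu T2 ->
    {ae mu, forall x, T1 x = T2 x}.

Definition ot_map (mu : probability R R) : R -> R :=
  epsilon (inhabits (fun x : R => x)) (is_ot_map mu).

Definition has_lip_density (mu : probability R R) : Prop :=
  exists f : R -> R,
    [/\ measurable_fun [set: R] f, (forall x, 0 <= f x),
        (exists L : R, forall x y, `|f x - f y| <= L * `|x - y|) &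
        forall A : set R, measurable A ->
          mu A = (\int[lebesgue_measure]_(x in A) (f x)%:E)%E].

Definition P_Lip : set (probability R R) :=
  [set mu | has_lip_density mu /\ ot_well_defined mu].

(* expectation over n i.i.d. samples of mu of a nonnegative functional,
   as the iterated integral w.r.t. mu (= integral w.r.t. mu^{(x) n}) *)
Fixpoint iid_expect (mu : probability R R) (n : nat)
  : (n.-tuple R -> \bar R) -> \bar R :=
  match n return (n.-tuple R -> \bar R) -> \bar R with
  | 0 => fun F => F [tuple]
  | n'.+1 => fun F =>
      (\int[mu]_x iid_expect mu (fun t : n'.-tuple R => F (cons_tuple x t)))%E
  end.

Definition estimators (n : nat) : set (n.-tuple R -> R -> R) :=
  [set Tn | measurable_fun [set: n.-tuple R * R]
              (fun z : n.-tuple R * R => Tn z.1 z.2)].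

Definition ot_risk (p : R) (n : nat) (Tn : n.-tuple R -> R -> R)
    (mu : probability R R) : \bar R :=
  iid_expect mu
    (fun s => (\int[mu]_x (`|Tn s x - ot_map mu x| `^ p)%:E)%E).

Definition minimax_risk (p : R) (n : nat) : \bar R :=
  ereal_inf [set ereal_sup [set ot_risk p Tn mu | mu in P_Lip]
            | Tn in @estimators n].

End OTminimax.

(* Main.v *)
(** Le Cam's two-point method. Take three unit-mass tent densities with disjoint supports
    [0, 2], [3, 5], [6, 8] and the mixtures with weights (1/2, u/2, (1-u)/2) and
    ((1-u)/2, u/2, 1/2). Their optimal maps to nu are the indicators of x > 5/2 and
    x > 11/2, which differ by 1 on the middle bump; since max(|t|, |t - 1|) >= 1/2, no
    estimator has loss below (u/2) 2^-p in total on the two measures. The likelihood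
    ratio L of one sample takes the values 1 - u, 1, 1/(1-u) and has second moment at
    most 1 + 2u^2, so with u = 1/(2 sqrt n) the n-sample ratio has second moment at
    most 2. The inequality min(1, L) >= L - L^2/4 then bounds the sum of the two risks
    below by half of that total loss. *)

Require Import Defs.
From HB Require Import structures.
From mathcomp Require Import all_boot all_order all_algebra.
From mathcomp Require Import all_classical all_reals all_analysis.
From mathcomp Require Import measurable_realfun ring lra.
Import Order.TTheory GRing.Theory Num.Theory.
Set Implicit Arguments.
Unset Strict Implicit.
Unset Printing Implicit Defensive.
Local Open Scope classical_set_scope.
Local Open Scope ring_scope.

(** * Tent functions and the probability measures with these densities *)

Section bump.
Variable R : realType.
Let leb := @lebesgue_measure R.

Definition bump (a x : R) : R := Num.max 0 (1 - `|x - a|).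

Lemma bump_ge0 a x : 0 <= bump a x.
Proof. by rewrite /bump le_max lexx. Qed.

Lemma bump_out a x : ~~ (a - 1 < x < a + 1) -> bump a x = 0.
Proof.
move=> H; apply: max_l; rewrite subr_le0; apply: contraR H.
by rewrite -ltNge ltr_distl.
Qed.

Lemma bump_lipschitz a x y : `|bump a x - bump a y| <= `|x - y|.
Proof.
have H u v : bump a u - bump a v <= `|u - v|.
  rewrite lerBlDr /bump ge_max; apply/andP; split.
    by rewrite addr_ge0// le_max lexx.
  apply: (@le_trans _ _ (`|u - v| + (1 - `|v - a|))); last first.
    by rewrite lerD2l le_max lexx orbT.
  have := ler_distD u v a; rewrite (distrC v u); lra.
by rewrite ler_norml H andbT lerNl opprB distrC H.
Qed.

Lemma measurable_bump a : measurable_fun [set: R] (bump a).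
Proof.
apply: measurable_maxr => //; apply: measurable_funB => //.
by apply: measurableT_comp => //; exact: measurable_funB.
Qed.

(** On the interval of length 1 around its centre the tent is at least 1/2. *)
Lemma integral_bump_gt0 a : (0 < \int[leb]_x (bump a x)%:E)%E.
Proof.
pose I : set R := `[a - 2^-1, a + 2^-1]%classic.
have mI : measurable I by exact: measurable_itv.
apply: (@lt_le_trans _ _ (\int[leb]_(x in I) (2^-1)%:E)%E).
  rewrite integral_cst//=.
  have -> : lebesgue_measure I = 1%E.
    rewrite /I lebesgue_measure_itv/= lte_fin ifT; last lra.
    by rewrite -EFinB; congr EFin; lra.
  by rewrite mule1 lte_fin.
apply: (@le_trans _ _ (\int[leb]_(x in I) (bump a x)%:E)%E).
  apply: ge0_le_integral => //=.
    by apply/measurable_funTS/measurable_EFinP; exact: measurable_bump.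
  move=> x; rewrite /I/= in_itv/= lee_fin -ler_distl => h.
  by rewrite /bump le_max; apply/orP; right; lra.
apply: ge0_subset_integral => //=.
- by apply/measurable_EFinP; exact: measurable_bump.
- by move=> x _; rewrite lee_fin bump_ge0.
Qed.

Lemma integral_bump_lty a : (\int[leb]_x (bump a x)%:E < +oo)%E.
Proof.
rewrite (_ : (fun x => (bump a x)%:E) =
  (fun x => (bump a x)%:E) \_ `[a - 1, a + 1]); last first.
  apply/funext => x; rewrite patchE; case: ifPn => //.
  rewrite notin_setE/= in_itv/= => /negP h.
  by rewrite bump_out//; apply: contra h => /andP[/ltW -> /ltW ->].
rewrite -integral_mkcond.
apply: (@le_lt_trans _ _ (\int[leb]_(x in `[(a - 1)%R, (a + 1)%R]) 1%E)%E).
  apply: ge0_le_integral => //=.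
  - by move=> x _; rewrite lee_fin bump_ge0.
  - by apply/measurable_funTS/measurable_EFinP; exact: measurable_bump.
  by move=> x _; rewrite lee_fin /bump ge_max ler01/= lerBlDr lerDl.
by rewrite integral_cst//= /leb lebesgue_measure_itv/= mul1e; case: ifP => // _;
  rewrite -EFinB ltry.
Qed.

(** Normalising by an unevaluated mass avoids computing the integral; the sequel relies only on its
    being positive and finite. *)
Definition bump_mass a : R := fine (\int[leb]_x (bump a x)%:E)%E.

Lemma bump_massE a : (bump_mass a)%:E = (\int[leb]_x (bump a x)%:E)%E.
Proof.
by rewrite /bump_mass fineK// ge0_fin_numE ?integral_bump_lty// ltW// integral_bump_gt0.
Qed.

Lemma bump_mass_gt0 a : 0 < bump_mass a.
Proof. by rewrite -lte_fin bump_massE integral_bump_gt0. Qed.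

Definition bump_pdf a x : R := bump a x / bump_mass a.

Lemma bump_pdf_ge0 a x : 0 <= bump_pdf a x.
Proof. by rewrite divr_ge0 ?bump_ge0// ltW// bump_mass_gt0. Qed.

Lemma measurable_bump_pdf a : measurable_fun [set: R] (bump_pdf a).
Proof. by apply: measurable_funM => //; exact: measurable_bump. Qed.

Definition bump_prob a (A : set R) : \bar R :=
  (\int[leb]_(x in A) (bump_pdf a x)%:E)%E.

Let bump_prob0 a : bump_prob a set0 = 0%E.
Proof. by rewrite /bump_prob integral_set0. Qed.

Let bump_prob_ge0 a A : (0 <= bump_prob a A)%E.
Proof. by apply: integral_ge0 => x _; rewrite lee_fin bump_pdf_ge0. Qed.

Let bump_prob_sigma_additive a : semi_sigma_additive (bump_prob a).
Proof.
have mf : measurable_fun [set: measurableTypeR R] (fun x => (bump_pdf a x)%:E).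
  by apply/measurable_EFinP; exact: measurable_bump_pdf.
have f0 x : (0 <= (bump_pdf a x)%:E)%E by rewrite lee_fin bump_pdf_ge0.
exact: (@semi_sigma_additive_nng_induced _ (measurableTypeR R) R leb _ mf f0).
Qed.

HB.instance Definition _ a := isMeasure.Build _ _ _ (bump_prob a)
  (bump_prob0 a) (bump_prob_ge0 a) (@bump_prob_sigma_additive a).

Let bump_prob_setT a : bump_prob a [set: R] = 1%E.
Proof.
rewrite /bump_prob /bump_pdf; under eq_integral do rewrite mulrC EFinM.
rewrite ge0_integralZl//=.
- by rewrite -bump_massE -EFinM mulVf// gt_eqF// bump_mass_gt0.
- by apply/measurable_EFinP; exact: measurable_bump.
- by move=> x _; rewrite lee_fin bump_ge0.
- by rewrite lee_fin invr_ge0 ltW// bump_mass_gt0.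
Qed.

HB.instance Definition _ a :=
  @Measure_isProbability.Build _ _ _ (bump_prob a) (bump_prob_setT a).

Lemma bump_prob_out a (A : set R) :
  (forall x, A x -> ~~ (a - 1 < x < a + 1)) -> bump_prob a A = 0%E.
Proof.
move=> hA; rewrite /bump_prob; apply: integral0_eq => x Ax.
by rewrite /bump_pdf bump_out ?mul0r//; exact: hA.
Qed.

Lemma bump_prob_in a (A : set R) : measurable A ->
  (forall x, a - 1 < x < a + 1 -> A x) -> bump_prob a A = 1%E.
Proof.
move=> mA hA.
have h : bump_prob a (~` A) = 0%E.
  by apply: bump_prob_out => x nAx; apply/negP => /hA; exact: nAx.
rewrite -(setCK A) [LHS](probability_setC (bump_prob a) (measurableC mA)).
by rewrite [X in (1 - X)%E]h sube0.
Qed.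

End bump.

(** * Optimality and almost sure uniqueness of the threshold map *)

Section threshold_map.
Variables (R : realType) (mu : probability R R) (m M : R).
(** The bound on [m] keeps the correction term [(m - 1/2) b] nonnegative. Uniqueness rests on the
    last two hypotheses: [mu_m] discards the point where both values cost the same, and [mu_M] makes
    the optimal cost finite, so that it cancels. *)
Hypotheses (m_ge : 2^-1 <= m) (mu_gt : mu `]m, +oo[%classic = (2^-1)%:E)
  (mu_m : mu [set m] = 0%E) (mu_M : {ae mu, forall x, `|x| <= M}).

Definition threshold (x : R) : R := (m < x)%R%:R.

Lemma measurable_threshold : measurable_fun [set: R] threshold.
Proof.
rewrite (_ : threshold = \1_(`]m, +oo[%classic)).
  exact: measurable_indic.
by apply/funext => x; rewrite /threshold indicE mem_setE in_itv/= andbT.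
Qed.

Lemma pushes_threshold : pushes mu threshold (@nu_target R).
Proof.
move=> A mA; rewrite /pushforward /nu_target.
have mu_le : mu `]-oo, m]%classic = (2^-1)%:E.
  rewrite -setCitvr probability_setC// mu_gt -EFinB; congr EFin; lra.
rewrite !diracE.
have T1 x : m < x -> threshold x = 1 by rewrite /threshold => ->.
have T0 x : x <= m -> threshold x = 0 by rewrite /threshold ltNge => ->.
have [A0|A0] := boolP (0 \in A); have [A1|A1] := boolP (1 \in A);
  rewrite /= ?mule1 ?mule0 ?adde0 ?add0e.
- rewrite (_ : _ @^-1` _ = setT).
    by rewrite probability_setT -EFinD; congr EFin; lra.
  apply/seteqP; split => // x _ /=; rewrite !inE in A0 A1.
  by case: (leP x m) => [/T0|/T1] ->.
- rewrite -mu_le; congr (mu _); apply/seteqP; split => x /=; rewrite in_itv/=.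
    by case: (leP x m) => // /T1 -> A1'; move: A1; rewrite notin_setE.
  by move=> /T0 ->; rewrite inE in A0.
- rewrite -mu_gt; congr (mu _); apply/seteqP; split => x /=;
    rewrite in_itv/= andbT.
    by case: (leP x m) => // /T0 -> A0'; move: A0; rewrite notin_setE.
  by move=> /T1 ->; rewrite inE in A1.
- rewrite (_ : _ @^-1` _ = set0) ?measure0//.
  apply/seteqP; split => // x /=; rewrite !notin_setE in A0 A1.
  by case: (leP x m) => [/T0|/T1] ->.
Qed.

Lemma measurable_qcost S : measurable_fun [set: R] S ->
  measurable_fun [set: R] (fun x => (qcost x (S x))%:E).
Proof.
move=> mS; apply/measurable_EFinP; apply: measurable_funM => //.
by apply: measurable_funX; exact: measurable_funB.
Qed.

Lemma qcost_ge0 (x y : R) : 0 <= qcost x y.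
Proof. by rewrite mulr_ge0// sqr_ge0. Qed.

(** For a map with values in {0, 1} this is the pointwise excess cost over [threshold], up to a term
    whose integral depends only on the pushforward. Using the indicator of [S = 1] instead of [S]
    makes it nonnegative everywhere, not merely almost everywhere. *)
Definition misplacement (S : R -> R) (x : R) : R :=
  (threshold x - \1_(S @^-1` [set 1]) x) * (x - m).

(** Among b in {0, 1}, the value [threshold x] maximises [b * (x - m)]. *)
Lemma misplacement_ge0 S x : 0 <= misplacement S x.
Proof.
rewrite /misplacement /threshold indicE; case: (leP x m) => xm;
  case: (x \in _); rewrite /=; nra.
Qed.

Lemma measurable_misplacement S : measurable_fun [set: R] S ->
  measurable_fun [set: R] (misplacement S).
Proof.
move=> mS; apply: measurable_funM; apply: measurable_funB => //.
  exact: measurable_threshold.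
by apply: measurable_indic; rewrite -[_ @^-1` _]setTI; exact: mS.
Qed.

(** The target gives no mass to the complement of {0, 1}, so the preimage of that complement is the
    exceptional null set. *)
Lemma pushes_ae01 S : measurable_fun [set: R] S -> pushes mu S (@nu_target R) ->
  {ae mu, forall x, S x = \1_(S @^-1` [set 1]) x}.
Proof.
move=> mS pS; exists (S @^-1` (~` [set 0; 1])); split.
- by rewrite -[_ @^-1` _]setTI; apply: mS => //; apply: measurableC; exact: measurableU.
- have := pS (~` [set 0; 1]); rewrite /pushforward => ->.
    rewrite /nu_target !diracE !memNset ?mule0 ?adde0//=; apply/not_orP; tauto.
  by apply: measurableC; exact: measurableU.
- move=> x /= h; apply: contra_not h => /= -[] Sx; rewrite indicE Sx.
    by rewrite memNset//= Sx => /eqP; rewrite eq_sym oner_eq0.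
  by rewrite mem_set.
Qed.

(* For b in {0, 1}, |x - b|^2 / 2 + (m - 1/2) b = x^2 / 2 - b (x - m), and both maps take
   the value 1 with mass 1/2. *)
Lemma qcost_threshold S : measurable_fun [set: R] S -> pushes mu S (@nu_target R) ->
  (\int[mu]_x (qcost x (S x))%:E =
   \int[mu]_x (qcost x (threshold x))%:E + \int[mu]_x (misplacement S x)%:E)%E.
Proof.
move=> mS pS; set B := S @^-1` [set 1].
have mB : measurable B by rewrite -[B]setTI; exact: mS.
have muB : mu B = (2^-1)%:E.
  have := pS [set 1] (measurable_set1 _); rewrite /pushforward => ->.
  rewrite /nu_target !diracE (_ : (1 \in _) = true); last exact: mem_set.
  rewrite memNset/= ?mule0 ?add0e ?mule1//.
  by move=> /esym/eqP; rewrite oner_eq0.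
have m0 : 0 <= m - 2^-1 by rewrite subr_ge0.
pose c := ((m - 2^-1) / 2)%:E.
have intB : (\int[mu]_x (\1_B x)%:E = (2^-1)%:E)%E.
  by rewrite integral_indic// setIT; exact: muB.
have cB : (\int[mu]_x ((m - 2^-1) * \1_B x)%:E)%E = c.
  under eq_integral do rewrite EFinM.
  rewrite ge0_integralZl//=; last first.
    by apply/measurable_EFinP; exact: measurable_indic.
  by rewrite intB -EFinM.
have intT : (\int[mu]_x (\1_(`]m, +oo[%classic) x)%:E = (2^-1)%:E)%E.
  by rewrite integral_indic// setIT; exact: mu_gt.
have cT : (\int[mu]_x ((m - 2^-1) * threshold x)%:E)%E = c.
  rewrite (_ : threshold = \1_(`]m, +oo[%classic)); last first.
    by apply/funext => x; rewrite /threshold indicE mem_setE in_itv/= andbT.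
  under eq_integral do rewrite EFinM.
  rewrite ge0_integralZl//=; last first.
    by apply/measurable_EFinP; exact: measurable_indic.
  by rewrite intT -EFinM.
have mcB : measurable_fun [set: R] (fun x => ((m - 2^-1) * \1_B x)%:E).
  by apply/measurable_EFinP; apply: measurable_funM => //; exact: measurable_indic.
have mcT : measurable_fun [set: R] (fun x => ((m - 2^-1) * threshold x)%:E).
  apply/measurable_EFinP; apply: measurable_funM => //; exact: measurable_threshold.
have mD : measurable_fun [set: R] (fun x => (misplacement S x)%:E).
  by apply/measurable_EFinP; exact: measurable_misplacement.
have qS0 (T : R -> R) (x : R) : [set: R] x -> (0 <= (qcost x (T x))%:E)%E.
  by rewrite lee_fin qcost_ge0.
have cB0 x : [set: R] x -> (0 <= ((m - 2^-1) * \1_B x)%:E)%E.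
  by rewrite lee_fin mulr_ge0.
have cT0 x : [set: R] x -> (0 <= ((m - 2^-1) * threshold x)%:E)%E.
  by rewrite lee_fin mulr_ge0// /threshold.
have D0 x : [set: R] x -> (0 <= (misplacement S x)%:E)%E.
  by rewrite lee_fin misplacement_ge0.
have mqS := measurable_qcost mS.
have mqT := measurable_qcost measurable_threshold.
pose qS x := (qcost x (S x))%:E; pose qT x := (qcost x (threshold x))%:E.
pose D x := (misplacement S x)%:E.
pose b x := ((m - 2^-1) * \1_B x)%:E; pose t x := ((m - 2^-1) * threshold x)%:E.
have qS0' x : [set: R] x -> (0 <= qS x)%E by exact: qS0.
have qT0 x : [set: R] x -> (0 <= qT x)%E by exact: qS0.
have qTD0 x : [set: R] x -> (0 <= qT x + D x)%E.
  by move=> ?; rewrite adde_ge0 ?qS0 ?D0.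
have mqTD : measurable_fun [set: R] (fun x => qT x + D x)%E.
  exact: emeasurable_funD.
(* Moving the correction terms to opposite sides leaves only nonnegative integrands, so the
   integrals split without integrability assumptions; the finite constant [c] cancels last. *)
have : (\int[mu]_x (qS x + b x) = \int[mu]_x (qT x + D x + t x))%E.
  apply: ge0_ae_eq_integral => //.
  - exact: emeasurable_funD.
  - exact: emeasurable_funD.
  - by move=> x _; rewrite adde_ge0 ?qS0 ?cB0.
  - by move=> x _; rewrite adde_ge0 ?qTD0 ?cT0.
  have := pushes_ae01 mS pS; apply: filterS => x Sx _.
  rewrite /qS /b /qT /D /t -!EFinD; congr EFin; rewrite Sx /misplacement -/B /qcost.
  rewrite /threshold indicE; case: (m < x); case: (x \in B) => /=; lra.
rewrite ge0_integralD// ge0_integralD// ge0_integralD// cB cT.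
by move=> /(congr1 (fun z => z - c)%E); rewrite !addeK.
Qed.

Lemma is_ot_map_threshold : is_ot_map mu threshold.
Proof.
split; [exact: measurable_threshold|exact: pushes_threshold|].
move=> S mS pS; rewrite (qcost_threshold mS pS) leeDl//.
by apply: integral_ge0 => x _; rewrite lee_fin misplacement_ge0.
Qed.

Lemma qcost_threshold_lty : (\int[mu]_x (qcost x (threshold x))%:E < +oo)%E.
Proof.
apply: (@le_lt_trans _ _ (\int[mu]_x (2^-1 * (M + 1) ^+ 2)%:E)%E); last first.
  by rewrite integral_cst//= probability_setT mule1 ltry.
apply: ae_ge0_le_integral => //.
- by move=> x _; rewrite lee_fin qcost_ge0.
- exact: (measurable_qcost measurable_threshold).
- by move=> x _; rewrite lee_fin mulr_ge0// sqr_ge0.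
apply: filterS mu_M => x xM _; rewrite lee_fin /qcost ler_pM2l//.
rewrite -(real_normK (num_real (x - _))) lerXn2r ?nnegrE//.
  by rewrite addr_ge0// (le_trans _ xM).
apply: (le_trans (ler_normB _ _)); rewrite lerD// /threshold.
by case: (m < x); rewrite ?normr1 ?normr0.
Qed.

(** Optimality of [S] and the cost identity force the nonnegative [misplacement S] to have integral
    0, hence to vanish almost everywhere. Off the null point [m] the factor [x - m] is nonzero, so
    the two indicators agree there. *)
Lemma is_ot_map_ae_threshold S : is_ot_map mu S ->
  {ae mu, forall x, S x = threshold x}.
Proof.
move=> [mS pS opt].
have := opt _ measurable_threshold pushes_threshold.
rewrite (qcost_threshold mS pS) => le0.
have D0 : (\int[mu]_x `|(misplacement S x)%:E| = 0)%E.
  under eq_integral do rewrite gee0_abs ?lee_fin ?misplacement_ge0//.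
  apply/eqP; rewrite eq_le; apply/andP; split; last first.
    by apply: integral_ge0 => x _; rewrite lee_fin misplacement_ge0.
  have fT : (\int[mu]_x (qcost x (threshold x))%:E)%E \is a fin_num.
    rewrite ge0_fin_numE ?qcost_threshold_lty//.
    by apply: integral_ge0 => x _; rewrite lee_fin qcost_ge0.
  by move: le0; rewrite -[X in (_ <= X)%E]adde0 leeD2lE.
have mD : measurable_fun [set: R] (fun x => (misplacement S x)%:E).
  by apply/measurable_EFinP; exact: measurable_misplacement.
have ae0 := (ae_eq_integral_abs mu measurableT mD).1 D0.
have aem : {ae mu, forall x, x <> m}.
  by exists [set m]; split => //= x /=; apply: contra_notP.
have aeS := pushes_ae01 mS pS.
move: ae0 aem aeS; apply: filterS3 => x /(_ I) /= D0x xm ->.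
move: D0x => [] /eqP; rewrite /misplacement mulf_eq0 subr_eq0 => /orP[/eqP -> //|].
by rewrite subr_eq0 => /eqP.
Qed.

Lemma ot_well_defined_threshold : ot_well_defined mu.
Proof.
split; first by exists threshold; exact: is_ot_map_threshold.
move=> S1 S2 /is_ot_map_ae_threshold h1 /is_ot_map_ae_threshold h2.
by move: h1 h2; apply: filterS2 => x -> ->.
Qed.

End threshold_map.

Lemma is_ot_map_ot_map (R : realType) (mu : probability R R) T :
  is_ot_map mu T -> is_ot_map mu (ot_map mu).
Proof. by move=> h; apply: ClassicalEpsilon.epsilon_spec; exists T. Qed.

(** * Finite mixtures of probability measures *)

Section mixture.
Variables (R : realType) (beta : nat -> probability R R) (k : nat).

Definition mix (w : nat -> {nonneg R}) : set R -> \bar R :=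
  msum (fun i => mscale (w i) (beta i)) k.

HB.instance Definition _ w := Measure.on (mix w).

Lemma mixE (w : nat -> {nonneg R}) A : mix w A = (\sum_(i < k) (w i)%:num%:E * beta i A)%E.
Proof. by []. Qed.

Lemma integral_mix (w : nat -> {nonneg R}) (f : R -> \bar R) : measurable_fun [set: R] f ->
  (forall x, 0 <= f x)%E ->
  (\int[mix w]_x f x = \sum_(i < k) (w i)%:num%:E * \int[beta i]_x f x)%E.
Proof.
move=> mf f0; rewrite ge0_integral_measure_sum//; apply: eq_bigr => i _.
by rewrite ge0_integral_mscale.
Qed.

Lemma mix_setT (w : nat -> {nonneg R}) : \sum_(i < k) (w i)%:num = 1 -> mix w [set: R] = 1%E.
Proof.
move=> w1; rewrite mixE; under eq_bigr do rewrite probability_setT mule1.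
by rewrite sumEFin w1.
Qed.

Section mix_prob.
Variables (w : nat -> {nonneg R}) (w1 : \sum_(i < k) (w i)%:num = 1).

(** The proof that the weights sum to 1 is an argument so that the probability structure can be
    attached to this name, while [mix] stays a plain measure. *)
Definition mix_prob & \sum_(i < k) (w i)%:num = 1 := mix w.

HB.instance Definition _ := Measure.on (mix_prob w1).
HB.instance Definition _ :=
  @Measure_isProbability.Build _ _ _ (mix_prob w1) (mix_setT w1).

End mix_prob.

End mixture.

(** * Positivity and measurability of iterated expectations *)

Section iid.
Variable R : realType.

Lemma iid_expect_ge0 (mu : probability R R) n (F : n.-tuple R -> \bar R) :
  (forall s, 0 <= F s)%E -> (0 <= iid_expect mu F)%E.
Proof.
elim: n F => [|n IH] F F0 /=; first exact: F0.
by apply: integral_ge0 => x _; apply: IH.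
Qed.

Lemma measurable_cons_tuple d (X : measurableType d) n :
  measurable_fun [set: X * R * n.-tuple R]
    (fun z => (z.1.1, cons_tuple z.1.2 z.2)).
Proof.
apply/measurable_fun_pairP; split => /=.
  exact: (measurableT_comp measurable_fst measurable_fst).
apply: measurable_cons => //.
exact: (measurableT_comp measurable_snd measurable_fst).
Qed.

(** The parameter space [X] is generalised in the induction: the first sample joins the parameter,
    and Tonelli's theorem integrates it out. *)
Lemma measurable_iid_expect (mu : probability R R) n d (X : measurableType d)
    (H : X * n.-tuple R -> \bar R) :
  measurable_fun [set: X * n.-tuple R] H -> (forall z, 0 <= H z)%E ->
  measurable_fun [set: X] (fun x => iid_expect mu (fun s => H (x, s))).
Proof.
elim: n d X H => [|n IH] d X H mH H0 /=.
  by apply: (measurableT_comp mH); exact: measurable_fun_pair.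
pose K (z : (X * R) * n.-tuple R) := H (z.1.1, cons_tuple z.1.2 z.2).
have mK : measurable_fun [set: X * R * n.-tuple R] K.
  exact: (measurableT_comp mH (@measurable_cons_tuple _ X n)).
apply: (@measurable_fun_fubini_tonelli_F _ _ X R R mu
  (fun xy => iid_expect mu (fun s => K (xy, s)))) => [|z].
  by apply: IH => // z; exact: H0.
by apply: iid_expect_ge0 => s; exact: H0.
Qed.

Lemma measurable_iid_expect_cons (mu : probability R R) n
    (F : n.+1.-tuple R -> \bar R) :
  measurable_fun [set: n.+1.-tuple R] F -> (forall s, 0 <= F s)%E ->
  measurable_fun [set: R] (fun x => iid_expect mu (fun s => F (cons_tuple x s))).
Proof.
move=> mF F0.
apply: (@measurable_iid_expect mu n _ R (fun z => F (cons_tuple z.1 z.2))) => //.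
apply: (measurableT_comp mF).
exact: measurable_cons.
Qed.

End iid.

(** * Le Cam's two-point inequality for mixtures *)

Section two_point.
Variables (R : realType) (beta : nat -> probability R R) (k : nat).
Variables (w v : nat -> {nonneg R}).
Hypotheses (w1 : \sum_(i < k) (w i)%:num = 1) (v1 : \sum_(i < k) (v i)%:num = 1).
(** [l i] is the likelihood ratio of the second mixture to the first on component [i]. Attaching it
    to the component rather than to the sample value lets the argument run on the weights alone. *)
Variables (l : nat -> R).
Hypotheses (l_ge0 : forall i, 0 <= l i)
  (vE : forall i, (v i)%:num = l i * (w i)%:num).

(* The induction carries the likelihood ratio u of the samples already drawn; the base
   case is the inequality min(1, u) >= u - u^2 / 4. *)
Lemma two_point_bound n (F G : n.-tuple R -> \bar R) (u delta : R) :
  0 <= u -> 0 <= delta ->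
  measurable_fun [set: n.-tuple R] F -> measurable_fun [set: n.-tuple R] G ->
  (forall s, 0 <= F s)%E -> (forall s, 0 <= G s)%E ->
  (forall s, delta%:E <= F s + G s)%E ->
  ((delta * u)%:E <= iid_expect (mix_prob beta w1) F +
    u%:E * iid_expect (mix_prob beta v1) G +
    (delta / 4 * u ^+ 2 * (\sum_(i < k) (w i)%:num * l i ^+ 2) ^+ n)%:E)%E.
Proof.
set rho := \sum_(i < k) _; move=> u0 delta0.
elim: n F G u u0 => [|n IH] F G u u0 mF mG F0 G0 FG /=.
  rewrite expr0 mulr1.
  move: (FG [tuple]) (F0 [tuple]) (G0 [tuple]).
  case: (F [tuple]) => [f| |]//; case: (G [tuple]) => [g| |]//=.
  - rewrite -EFinD -EFinM -!EFinD !lee_fin => fg f0 g0.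
    (* [f + u g] is at least [min(1, u) * delta]; for [u > 1] the square [(u / 2 - 1)^2] then yields
       [u - u^2 / 4 <= 1]. *)
    case: (leP u 1) => u1.
      have : 0 <= u * (f + g - delta) by rewrite mulr_ge0// subr_ge0.
      have : 0 <= f * (1 - u) by rewrite mulr_ge0// subr_ge0.
      have : 0 <= delta * u ^+ 2 by rewrite mulr_ge0// sqr_ge0.
      lra.
    have : 0 <= delta * (u / 2 - 1) ^+ 2 by rewrite mulr_ge0// sqr_ge0.
    have : 0 <= g * (u - 1) by rewrite mulr_ge0// subr_ge0 ltW.
    nra.
  (* Here [G] is infinite. For [u = 0] the product [u * G] is 0 by convention, and the bound reduces
     to [0 <= F]. *)
  - move=> _ f0 _; have [->|un0] := eqVneq u 0.
      rewrite mul0e adde0 mulr0 expr0n/= mulr0 adde0; exact: f0.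
    by rewrite gt0_muley ?lte_fin ?lt_def ?un0// addey// addye// leey.
  - by move=> _ _ g0; rewrite addye ?addye ?leey// -ltNye (lt_le_trans (ltNy0)).
  - move=> _ _ _; have [->|un0] := eqVneq u 0.
      by rewrite mul0e adde0 addye ?leey.
    by rewrite gt0_muley ?lte_fin ?lt_def ?un0// addey// addye// leey.
pose a x := iid_expect (mix_prob beta w1) (fun s => F (cons_tuple x s)).
pose b x := iid_expect (mix_prob beta v1) (fun s => G (cons_tuple x s)).
change ((delta * u)%:E <= \int[mix beta k w]_x a x + u%:E * \int[mix beta k v]_x b x +
  (delta / 4 * u ^+ 2 * rho ^+ n.+1)%:E)%E.
have ma : measurable_fun [set: R] a by exact: measurable_iid_expect_cons.
have mb : measurable_fun [set: R] b by exact: measurable_iid_expect_cons.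
have a0 x : (0 <= a x)%E by exact: iid_expect_ge0.
have b0 x : (0 <= b x)%E by exact: iid_expect_ge0.
have mcons x : measurable_fun [set: n.-tuple R] (fun s => cons_tuple x s).
  by apply: measurable_cons.
have rho0 : 0 <= rho by apply: sumr_ge0 => i _; rewrite mulr_ge0// sqr_ge0.
(* Once the first sample is drawn from component [i], the running ratio becomes [u * l i]; the
   induction hypothesis holds for every value of that sample and is integrated against [beta i]. *)
have step i : ((delta * (u * l i))%:E <= \int[beta i]_x a x +
    (u * l i)%:E * \int[beta i]_x b x +
    (delta / 4 * (u * l i) ^+ 2 * rho ^+ n)%:E)%E.
  have ul0 : 0 <= u * l i by rewrite mulr_ge0.
  have c0 : 0 <= delta / 4 * (u * l i) ^+ 2 * rho ^+ n.
    by rewrite !mulr_ge0 ?sqr_ge0 ?exprn_ge0.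
  have mub : measurable_fun [set: R] (fun x => (u * l i)%:E * b x)%E.
    exact: measurable_funeM.
  have <- : (\int[beta i]_x (delta * (u * l i))%:E = (delta * (u * l i))%:E)%E.
    by rewrite integral_cst//= probability_setT mule1.
  apply: (@le_trans _ _ (\int[beta i]_x (a x + (u * l i)%:E * b x +
      (delta / 4 * (u * l i) ^+ 2 * rho ^+ n)%:E))%E); last first.
    have ub0 x : [set: R] x -> (0 <= (u * l i)%:E * b x)%E by rewrite mule_ge0.
    have aub0 x : [set: R] x -> (0 <= a x + (u * l i)%:E * b x)%E.
      by move=> ?; rewrite adde_ge0// ub0.
    have maub := emeasurable_funD ma mub.
    rewrite ge0_integralD// ge0_integralD//.
    by rewrite ge0_integralZl// integral_cst//= probability_setT mule1.
  apply: ge0_le_integral => //.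
  - by move=> x _; rewrite lee_fin mulr_ge0.
  - by apply: emeasurable_funD => //; exact: emeasurable_funD.
  - move=> x _; apply: IH => //.
    + exact: (measurableT_comp mF (mcons x)).
    + exact: (measurableT_comp mG (mcons x)).
(* Averaging with the weights [w]: [w i * l i = v i] turns the left side into [delta * u] and the
   middle term into an integral against the second mixture, while the sum of [w i * l i ^+ 2]
   supplies one more factor [rho]. *)
have {step} : (\sum_(i < k) (w i)%:num%:E * (delta * (u * l i))%:E <=
    \sum_(i < k) (w i)%:num%:E * (\int[beta i]_x a x +
    (u * l i)%:E * \int[beta i]_x b x +
    (delta / 4 * (u * l i) ^+ 2 * rho ^+ n)%:E))%E.
  by apply: lee_sum => i _; rewrite lee_wpmul2l// step.
have -> : (\sum_(i < k) (w i)%:num%:E * (delta * (u * l i))%:E = (delta * u)%:E)%E.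
  under eq_bigr do rewrite -EFinM.
  rewrite sumEFin; congr EFin; rewrite -[RHS]mulr1 -v1 mulr_sumr.
  by apply: eq_bigr => i _; rewrite vE; ring.
move=> /le_trans; apply.
rewrite integral_mix// integral_mix// ge0_sume_distrr; last first.
  move=> i _; apply: mule_ge0; first by rewrite lee_fin.
  by apply: integral_ge0 => x _; exact: b0.
rewrite (_ : delta / 4 * u ^+ 2 * rho ^+ n.+1 =
  \sum_(i < k) (w i)%:num * (delta / 4 * (u * l i) ^+ 2 * rho ^+ n)); last first.
  rewrite [rho ^+ _]exprS mulrCA mulr_suml; apply: eq_bigr => i _; ring.
rewrite -sumEFin -!big_split/=; apply: lee_sum => i _.
have Ia : (0 <= \int[beta i]_x a x)%E by apply: integral_ge0.
have Ib : (0 <= \int[beta i]_x b x)%E by apply: integral_ge0.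
have ulb0 : (0 <= (u * l i)%:E * \int[beta i]_x b x)%E.
  by rewrite mule_ge0// lee_fin mulr_ge0.
have c0 : (0 <= (delta / 4 * (u * l i) ^+ 2 * rho ^+ n)%:E)%E.
  by rewrite lee_fin !mulr_ge0 ?sqr_ge0 ?exprn_ge0.
rewrite ge0_muleDr ?(adde_ge0 Ia ulb0)// ge0_muleDr//.
rewrite vE !muleA -!EFinM.
rewrite (_ : (w i)%:num * (u * l i) = u * (l i * (w i)%:num)); last ring.
exact: lexx.
Qed.

End two_point.

(** * Lipschitz densities of the mixtures and elementary estimates *)

Lemma has_lip_density_mix (R : realType) (a : nat -> R) k (w : nat -> {nonneg R})
    (w1 : \sum_(i < k) (w i)%:num = 1) :
  has_lip_density (mix_prob (fun i => bump_prob (a i) : probability R R) w1).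
Proof.
exists (fun x => \sum_(i < k) (w i)%:num * bump_pdf (a i) x); split.
- apply: measurable_sum => i; apply: measurable_funM => //.
  exact: measurable_bump_pdf.
- by move=> x; apply: sumr_ge0 => i _; rewrite mulr_ge0// bump_pdf_ge0.
(* A tent is 1-Lipschitz, so its normalisation has Lipschitz constant [1 / bump_mass]. *)
- exists (\sum_(i < k) (w i)%:num / bump_mass (a i)) => x y.
  rewrite -sumrB mulr_suml; apply: (le_trans (ler_norm_sum _ _ _)).
  apply: ler_sum => i _; rewrite -mulrBr normrM ger0_norm// -mulrA.
  rewrite ler_wpM2l// /bump_pdf -mulrBl normrM mulrC.
  by rewrite gtr0_norm ?invr_gt0 ?bump_mass_gt0// ler_pM2l ?invr_gt0
    ?bump_mass_gt0// bump_lipschitz.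
move=> A mA; under eq_integral do rewrite -sumEFin.
rewrite ge0_integral_sum//; last 2 first.
- move=> i; apply/measurable_funTS/measurable_EFinP/measurable_funM => //.
  exact: measurable_bump_pdf.
- by move=> i x _; rewrite lee_fin mulr_ge0// bump_pdf_ge0.
apply: eq_bigr => i _; under eq_integral do rewrite EFinM.
rewrite ge0_integralZl//.
- by apply/measurable_funTS/measurable_EFinP; exact: measurable_bump_pdf.
- by move=> x _; rewrite lee_fin bump_pdf_ge0.
Qed.

Lemma integral_mix_ge (R : realType) (beta : nat -> probability R R) k
    (w : nat -> {nonneg R}) (i : 'I_k) (f : R -> \bar R) :
  measurable_fun [set: R] f -> (forall x, 0 <= f x)%E ->
  ((w i)%:num%:E * \int[beta i]_x f x <= \int[mix beta k w]_x f x)%E.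
Proof.
move=> mf f0; rewrite integral_mix// (bigD1 i)//= leeDl//.
apply: sume_ge0 => j _; apply: mule_ge0; first by rewrite lee_fin.
by apply: integral_ge0 => x _; exact: f0.
Qed.

(** The induction rests on [(1 + x) (1 - (n + 1) x) = 1 - n x - (n + 1) x^2], which gives
    [(1 + x)^n (1 - n x) <= 1]; the second factor is at least 1/2. *)
Lemma exprDn_le2 (R : realFieldType) (x : R) n :
  0 <= x -> n%:R * x <= 2^-1 -> (1 + x) ^+ n <= 2.
Proof.
move=> x0 nx.
suff H : (1 + x) ^+ n * (1 - n%:R * x) <= 1.
  have : (1 + x) ^+ n * 2^-1 <= 1.
    apply: le_trans H; apply: ler_wpM2l; first by rewrite exprn_ge0// addr_ge0.
    lra.
  lra.
elim: n {nx} => [|n IH]; first by rewrite expr0 mul0r subr0 mulr1.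
apply: le_trans IH; rewrite exprSr -mulrA.
apply: ler_wpM2l; first by rewrite exprn_ge0// addr_ge0.
have : 0 <= n.+1%:R * x ^+ 2 by rewrite mulr_ge0// sqr_ge0.
rewrite -natr1; lra.
Qed.

Section loss.
Variables (R : realType) (p : R).
Hypothesis hp : 1 <= p.

Lemma measurable_loss (S T : R -> R) : measurable_fun [set: R] S ->
  measurable_fun [set: R] T ->
  measurable_fun [set: R] (fun x => (`|S x - T x| `^ p)%:E).
Proof.
move=> mS mT; apply/measurable_EFinP.
apply: (measurableT_comp (measurable_powR p)).
by apply: measurableT_comp => //; exact: measurable_funB.
Qed.

(** Every real is at distance at least 1/2 from 0 or from 1. *)
Lemma half_powR_le (s : R) : 2^-1 `^ p <= `|s - 1| `^ p + `|s - 0| `^ p.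
Proof.
have p0 : 0 <= p by exact: le_trans hp.
rewrite subr0; have [h|h] := leP (2^-1) `|s|.
  by apply: ler_wpDl; rewrite ?powR_ge0// ge0_ler_powR// nnegrE.
apply: ler_wpDr; rewrite ?powR_ge0// ge0_ler_powR// ?nnegrE//.
by move: h; rewrite ltr_norml => /andP[_ h]; rewrite ler0_norm; lra.
Qed.

End loss.

(** * Three separated bumps and transport from their mixtures *)

Section three_bumps.
Variable R : realType.

(** Centres [3 i + 1] leave gaps of length 1 between consecutive supports; the midpoints 5/2 and
    11/2 of the first two gaps are the thresholds. *)
Definition sep_bump (i : nat) : probability R R := bump_prob (3 * i%:R + 1).

Lemma sep_bump_out i (A : set R) :
  (forall x, A x -> ~~ (3 * i%:R < x < 3 * i%:R + 2)) -> sep_bump i A = 0%E.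
Proof.
move=> hA; apply: bump_prob_out => x /hA; apply: contra => /andP[h1 h2].
by apply/andP; split; lra.
Qed.

Lemma sep_bump_in i (A : set R) : measurable A ->
  (forall x, 3 * i%:R < x < 3 * i%:R + 2 -> A x) -> sep_bump i A = 1%E.
Proof.
move=> mA hA; apply: bump_prob_in => // x /andP[h1 h2].
by apply: hA; apply/andP; split; lra.
Qed.

Definition weights3 (x y z : {nonneg R}) (i : nat) : {nonneg R} :=
  match i with 0 => x | 1 => y | _ => z end.

Lemma mix3E (w : nat -> {nonneg R}) A : mix sep_bump 3 w A =
  ((w 0)%:num%:E * sep_bump 0 A + (w 1)%:num%:E * sep_bump 1 A + (w 2)%:num%:E * sep_bump 2 A)%E.
Proof. by rewrite mixE !big_ord_recr big_ord0/= add0e. Qed.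

Variables (w : nat -> {nonneg R}) (w1 : \sum_(i < 3) (w i)%:num = 1).
Let mu : probability R R := mix_prob sep_bump w1.

Lemma mix3_bounded : {ae mu, forall x, `|x| <= 8}.
Proof.
exists (~` `[-8, 8]%classic); split.
- by apply: measurableC; exact: measurable_itv.
- rewrite [LHS]mix3E !sep_bump_out ?mule0 ?adde0// => x /=;
    rewrite in_itv/= => /negP h; apply: contra h => /andP[h1 h2];
    apply/andP; split; lra.
- by move=> x /=; rewrite in_itv/= ler_norml.
Qed.

Lemma mix3_set1 m : (m == 5 / 2) || (m == 11 / 2) -> mu [set m] = 0%E.
Proof.
move=> mm; rewrite [LHS]mix3E !sep_bump_out ?mule0 ?adde0// => x /= ->;
  apply/negP => /andP[h1 h2]; case/orP : mm => /eqP mm; lra.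
Qed.

End three_bumps.

Section three_bumps_transport.
Variables (R : realType) (w : nat -> {nonneg R}).
Variables (w1 : \sum_(i < 3) (w i)%:num = 1) (m : R).
Let mu : probability R R := mix_prob (@sep_bump R) w1.
Hypotheses (m_gap : (m == 5 / 2) || (m == 11 / 2))
  (mu_gt : mu `]m, +oo[%classic = (2^-1)%:E).

Let m_ge : 2^-1 <= m.
Proof. by case/orP : m_gap => /eqP ->; lra. Qed.

Lemma P_Lip_mix3 : P_Lip mu.
Proof.
split; first exact: has_lip_density_mix.
apply: (ot_well_defined_threshold m_ge mu_gt _ (mix3_bounded w1)).
exact: mix3_set1.
Qed.

Lemma is_ot_map_mix3 : is_ot_map mu (ot_map mu).
Proof. by apply: is_ot_map_ot_map; exact: (is_ot_map_threshold m_ge mu_gt). Qed.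

(** The chosen optimal map equals [threshold m] almost everywhere, and discarding the two outer
    bumps only lowers the integral of a nonnegative loss. *)
Lemma loss_mix3_ge p (S : R -> R) : measurable_fun [set: R] S ->
  ((w 1)%:num%:E * \int[sep_bump R 1]_x (`|S x - threshold m x| `^ p)%:E <=
   \int[mu]_x (`|S x - ot_map mu x| `^ p)%:E)%E.
Proof.
move=> mS; have mT := @measurable_threshold R m.
have [mO _ _] := is_ot_map_mix3.
have -> : (\int[mu]_x (`|S x - ot_map mu x| `^ p)%:E =
    \int[mu]_x (`|S x - threshold m x| `^ p)%:E)%E.
  apply: ge0_ae_eq_integral => //; do ?exact: measurable_loss.
  have mu_m : mu [set m] = 0%E by exact: mix3_set1.
  have := is_ot_map_ae_threshold m_ge mu_gt mu_m (mix3_bounded w1) is_ot_map_mix3.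
  by apply: filterS => x -> _.
apply: (@integral_mix_ge R (@sep_bump R) 3 w 1); first exact: measurable_loss.
by move=> x; rewrite lee_fin powR_ge0.
Qed.

End three_bumps_transport.

(** * Separation of the two maps and the minimax lower bound *)

Lemma loss_sep_bump_ge (R : realType) (p : R) (S : R -> R) : 1 <= p ->
  measurable_fun [set: R] S ->
  ((2^-1 `^ p)%:E <=
   \int[sep_bump R 1]_x (`|S x - threshold (5 / 2) x| `^ p)%:E +
   \int[sep_bump R 1]_x (`|S x - threshold (11 / 2) x| `^ p)%:E)%E.
Proof.
move=> hp mS.
have mT m := measurable_loss p mS (@measurable_threshold R m).
have T0 m x : [set: R] x -> (0 <= (`|S x - threshold m x| `^ p)%:E)%E.
  by rewrite lee_fin powR_ge0.
rewrite -ge0_integralD//.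
rewrite -[leLHS]mule1 -(probability_setT (sep_bump R 1)) -integral_cst//.
apply: ae_ge0_le_integral => //.
- by move=> x _; rewrite lee_fin powR_ge0.
- by move=> x _; rewrite adde_ge0// T0.
- exact: emeasurable_funD.
exists (~` `[3, 5]%classic); split.
- by apply: measurableC; exact: measurable_itv.
- apply: sep_bump_out => x /=; rewrite in_itv/= => /negP; apply: contra => /andP[h1 h2].
  by apply/andP; split; lra.
- move=> x /=; apply: contra_not; rewrite in_itv/= => /andP[x3 x5] _.
  (* On the middle bump the two thresholds give the values 1 and 0. *)
  rewrite -EFinD lee_fin /threshold (_ : (5 / 2 < x) = true); last by apply/idP; lra.
  rewrite (_ : (11 / 2 < x) = false); last by apply/negbTE; rewrite -leNgt; lra.
  exact: half_powR_le.
Qed.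

(** In the application [s] is the worst-case risk and [q] bounds the second moment of the likelihood
    ratio. The penalty is at most [d / 2], whence [d <= 2 s + d / 2]. *)
Lemma le_cam_quarter (R : realType) (d q : R) (a b s : \bar R) :
  0 <= d -> q <= 2 -> (a <= s)%E -> (b <= s)%E ->
  ((d * 1)%:E <= a + 1%:E * b + (d / 4 * 1 ^+ 2 * q)%:E)%E -> ((d / 4)%:E <= s)%E.
Proof.
move=> d0 q2 sa sb; rewrite mul1e mulr1 expr1n mulr1 => H.
have {H} : (d%:E <= s + s + (d / 2)%:E)%E.
  apply: (le_trans H); apply: leeD; first exact: leeD.
  rewrite lee_fin; have := ler_wpM2l d0 q2; lra.
case: s {sa sb} => [s| |]; [|by move=> _; exact: leey|by []].
rewrite -!EFinD !lee_fin; lra.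
Qed.

(** The bound is a quarter of the total loss [u / 2 * 2^-p]; the last condition on [u] keeps
    [(1 + 2 u^2)^n] at most 2. *)
Lemma two_point_risk_ge (R : realType) (p u : R) (n : nat) :
  1 <= p -> 0 < u -> u <= 2^-1 -> n%:R * (2 * u ^+ 2) <= 2^-1 ->
  ((u / 8 * 2^-1 `^ p)%:E <= minimax_risk p n)%E.
Proof.
move=> hp u0 u1 nu.
have e0 : 0 <= u / 2 by lra.
have r0 : 0 <= (1 - u) / 2 by lra.
have h0 : 0 <= 1 / 2 :> R by lra.
(* Since [u / 2 + (1 - u) / 2 = 1/2], half of the mass lies beyond 5/2 under [w]; reversing the
   weights moves the balance point to 11/2. *)
pose w := weights3 (NngNum h0) (NngNum e0) (NngNum r0).
pose v := weights3 (NngNum r0) (NngNum e0) (NngNum h0).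
have w1 : \sum_(i < 3) (w i)%:num = 1.
  by rewrite !big_ord_recr big_ord0/=; lra.
have v1 : \sum_(i < 3) (v i)%:num = 1.
  by rewrite !big_ord_recr big_ord0/=; lra.
pose mu : probability R R := mix_prob (@sep_bump R) w1.
pose nu' : probability R R := mix_prob (@sep_bump R) v1.
have mu_gt : mu `]5 / 2, +oo[%classic = (2^-1)%:E.
  have b0 : sep_bump R 0 `]5 / 2, +oo[%classic = 0%E.
    apply: sep_bump_out => x; rewrite /= in_itv/= andbT => h.
    by apply/negP => /andP[h1 h2]; lra.
  have b1 : sep_bump R 1 `]5 / 2, +oo[%classic = 1%E.
    by apply: sep_bump_in => // x /andP[h1 h2]; rewrite /= in_itv/= andbT; lra.
  have b2 : sep_bump R 2 `]5 / 2, +oo[%classic = 1%E.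
    by apply: sep_bump_in => // x /andP[h1 h2]; rewrite /= in_itv/= andbT; lra.
  rewrite [LHS]mix3E b0 b1 b2 mule0 add0e !mule1 -EFinD; congr EFin.
  by rewrite /=; lra.
have nu_gt : nu' `]11 / 2, +oo[%classic = (2^-1)%:E.
  have b0 : sep_bump R 0 `]11 / 2, +oo[%classic = 0%E.
    apply: sep_bump_out => x; rewrite /= in_itv/= andbT => h.
    by apply/negP => /andP[h1 h2]; lra.
  have b1 : sep_bump R 1 `]11 / 2, +oo[%classic = 0%E.
    apply: sep_bump_out => x; rewrite /= in_itv/= andbT => h.
    by apply/negP => /andP[h1 h2]; lra.
  have b2 : sep_bump R 2 `]11 / 2, +oo[%classic = 1%E.
    by apply: sep_bump_in => // x /andP[h1 h2]; rewrite /= in_itv/= andbT; lra.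
  rewrite [LHS]mix3E b0 b1 b2 !mule0 !add0e mule1; congr EFin.
  by rewrite /=; lra.
have gap1 : (5 / 2 == 5 / 2 :> R) || (5 / 2 == 11 / 2 :> R) by rewrite eqxx.
have gap2 : (11 / 2 == 5 / 2 :> R) || (11 / 2 == 11 / 2 :> R) by rewrite eqxx orbT.
pose l (i : nat) : R := match i with 0 => 1 - u | 1 => 1 | _ => (1 - u)^-1 end.
have l0 i : 0 <= l i by case: i => [|[|i]] //=; rewrite ?invr_ge0; lra.
have vE i : (v i)%:num = l i * (w i)%:num.
  by case: i => [|[|i]] //=; [lra|lra|field; lra].
have rho_le : \sum_(i < 3) (w i)%:num * l i ^+ 2 <= 1 + 2 * u ^+ 2.
  rewrite !big_ord_recr big_ord0/= add0r expr1n mulr1.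
  rewrite (_ : (1 - u) / 2 * (1 - u)^-1 ^+ 2 = 2^-1 / (1 - u)); last by field; lra.
  (* [(1 + u + 2 u^2) (1 - u) = 1 + u^2 (1 - 2 u)] is at least 1 because [u <= 1/2]. The second
     moment is then at most [1 + 3/2 u^2]. *)
  have : (1 - u)^-1 <= 1 + u + 2 * u ^+ 2.
    rewrite -[leLHS]mul1r ler_pdivrMr; last lra.
    have : 0 <= u ^+ 2 * (1 - 2 * u) by rewrite mulr_ge0 ?sqr_ge0//; lra.
    lra.
  have : 0 <= u ^+ 2 by rewrite sqr_ge0.
  lra.
have rho0 : 0 <= \sum_(i < 3) (w i)%:num * l i ^+ 2.
  by apply: sumr_ge0 => i _; rewrite mulr_ge0// sqr_ge0.
have rhon : (\sum_(i < 3) (w i)%:num * l i ^+ 2) ^+ n <= 2.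
  apply: le_trans (exprDn_le2 _ nu); last by rewrite mulr_ge0// sqr_ge0.
  by apply: lerXn2r rho_le; rewrite nnegrE// addr_ge0// mulr_ge0// sqr_ge0.
apply: le_ereal_inf_tmp => _ [Tn mTn <-].
have mTs s : measurable_fun [set: R] (Tn s).
  exact: (measurableT_comp mTn (measurable_pair1 s)).
pose F (la : probability R R) s := (\int[la]_x (`|Tn s x - ot_map la x| `^ p)%:E)%E.
have F0 la s : (0 <= F la s)%E.
  by apply: integral_ge0 => x _; rewrite lee_fin powR_ge0.
(* Measurability of the loss in the samples needs that of [ot_map la], which comes with
   optimality. *)
have mF la : is_ot_map la (ot_map la) -> measurable_fun [set: n.-tuple R] (F la).
  move=> [mO _ _].
  apply: (@measurable_fun_fubini_tonelli_F _ _ (n.-tuple R) R R la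
    (fun z => (`|Tn z.1 z.2 - ot_map la z.2| `^ p)%:E)).
    apply/measurable_EFinP; apply: (measurableT_comp (measurable_powR p)).
    apply: measurableT_comp => //; apply: measurable_funB => //.
    exact: (measurableT_comp mO measurable_snd).
  by move=> z; rewrite lee_fin powR_ge0.
(* The middle bump has the same weight [u / 2] in both mixtures. *)
have FG s : ((u / 2 * 2^-1 `^ p)%:E <= F mu s + F nu' s)%E.
  apply: le_trans (leeD (loss_mix3_ge gap1 mu_gt p (mTs s))
    (loss_mix3_ge gap2 nu_gt p (mTs s))).
  rewrite /= -ge0_muleDr; last 2 first.
  - by apply: integral_ge0 => x _; rewrite lee_fin powR_ge0.
  - by apply: integral_ge0 => x _; rewrite lee_fin powR_ge0.
  by rewrite EFinM lee_wpmul2l ?lee_fin// loss_sep_bump_ge.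
have d0 : 0 <= u / 2 * 2^-1 `^ p by rewrite mulr_ge0// powR_ge0.
rewrite (_ : u / 8 * 2^-1 `^ p = u / 2 * 2^-1 `^ p / 4); last by field.
(* The likelihood ratio starts at 1, before any sample is drawn. *)
have H := @two_point_bound R (@sep_bump R) 3 w v w1 v1 l l0 vE n (F mu) (F nu') 1 _
  ler01 d0 (mF mu (is_ot_map_mix3 gap1 mu_gt)) (mF nu' (is_ot_map_mix3 gap2 nu_gt))
  (F0 mu) (F0 nu') FG.
refine (@le_cam_quarter R _ _ _ _ _ d0 rhon _ _ H).
- by apply: ereal_sup_ubound; exists mu => //; exact: P_Lip_mix3 gap1 mu_gt.
- by apply: ereal_sup_ubound; exists nu' => //; exact: P_Lip_mix3 gap2 nu_gt.
Qed.

Theorem theorem5p3 (R : realType) (p : R) (hp : 1 <= p) :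
  exists c : R, 0 < c /\
    exists N : nat, forall n : nat, (N <= n)%N ->
      ((c / Num.sqrt n%:R)%:E <= minimax_risk p n)%E.
Proof.
(* With [u = 1 / (2 sqrt n)] the bound [u / 8 * 2^-p] equals [2^-p / (16 sqrt n)], and [n * 2 u^2]
   is exactly 1/2. Taking [n >= 1] ensures [u <= 1/2]. *)
exists (2^-1 `^ p / 16); split; first by rewrite divr_gt0// powR_gt0.
exists 1%N => n n1.
have n0 : 1 <= n%:R :> R by rewrite ler1n.
have s1 : 1 <= Num.sqrt n%:R :> R by rewrite -[leLHS]sqrtr1 ler_sqrt // (lt_le_trans ltr01 n0).
have ss : Num.sqrt n%:R ^+ 2 = n%:R :> R by rewrite sqr_sqrtr// ler0n.
set s := Num.sqrt _ in s1 ss *.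
have s0 : s != 0 by rewrite gt_eqF// (lt_le_trans ltr01).
rewrite (_ : _ / _ / _ = (2 * s)^-1 / 8 * 2^-1 `^ p); last by field.
apply: two_point_risk_ge => //.
- by rewrite invr_gt0; lra.
- by rewrite lef_pV2 ?posrE; lra.
- by rewrite -ss (_ : _ * _ = 2^-1)//; field.
Qed.
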